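(* Let $(H,\mathcal{R},\chi)$ be a pre-Cartier bialgebra satisfying one of the following equivalent conditions in $H^{\otimes 3}$: $$[\chi_{12},\mathcal{R}_{12}^{-1}\chi_{13}\mathcal{R}_{12}]=0,\qquad [\chi_{23},\mathcal{R}_{23}^{-1}\chi_{13}\mathcal{R}_{23}]=0,\qquad [\chi_{12},\chi_{23}]=0.$$ Then $$\tilde{\mathcal{R}}:=\mathcal{R}\exp(\hbar\chi)$$ is a quasitriangular structure on the trivial topological bialgebra $\tilde H:=H[[\hbar]]$.
   Context: $\Bbbk$ is a field of characteristic zero; algebras are associative unital over $\Bbbk$, $\otimes=\otimes_\Bbbk$. For $A=\sum A^1\otimes A^2\in H\otimes H$ put $A_{12}=A\otimes 1$, $A_{23}=1\otimes A$, $A_{13}=\sum A^1\otimes 1\otimes A^2$; $[\cdot,\cdot]$ is the commutator; $\Delta^{\mathrm{op}}$ is $\Delta$ followed by the flip. A quasitriangular structure on a bialgebra $(H,\Delta,\varepsilon)$ is an invertible $\mathcal{R}\in H\otimes H$ with $\Delta^{\mathrm{op}}(\cdot)=\mathcal{R}\Delta(\cdot)\mathcal{R}^{-1}$, $(\mathrm{id}\otimes\Delta)(\mathcal{R})=\mathcal{R}_{13}\mathcal{R}_{12}$, $(\Delta\otimes\mathrm{id})(\mathcal{R})=\mathcal{R}_{13}\mathcal{R}_{23}$. A pre-Cartier bialgebra is a bialgebra with a quasitriangular structure $\mathcal{R}$ together with an element $\chi\in H\otimes H$ such that $\chi\Delta(\cdot)=\Delta(\cdot)\chi$, $(\mathrm{id}\otimes\Delta)(\chi)=\chi_{12}+\mathcal{R}_{12}^{-1}\chi_{13}\mathcal{R}_{12}$,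 $(\Delta\otimes\mathrm{id})(\chi)=\chi_{23}+\mathcal{R}_{23}^{-1}\chi_{13}\mathcal{R}_{23}$. The trivial topological bialgebra $\tilde H=H[[\hbar]]$ carries the $\hbar$-linear extensions of the product, unit, $\Delta$ and $\varepsilon$ of $H$, with $\otimes$ replaced by the $\hbar$-adically completed tensor product over $\Bbbk[[\hbar]]$, so $\tilde H^{\tilde\otimes n}\cong H^{\otimes n}[[\hbar]]$; a quasitriangular structure on it is an invertible element of $(H\otimes H)[[\hbar]]$ satisfying the axioms above for these extended maps. *)

(* Defs.v *)
From HB Require Import structures.
From mathcomp Require Import all_boot all_order all_algebra.
From mathcomp Require Import generic_quotient.
From mathcomp Require Import boolp.
From mathcomp Require classical_sets.

Set Implicit Arguments.
Unset Strict Implicit.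
Unset Printing Implicit Defensive.

Import GRing.Theory.
Local Open Scope ring_scope.
Local Open Scope quotient_scope.

(** * Tensor product of two vector spaces *)

Section TensorProduct.
Variables (k : fieldType) (V W : lmodType k).

(** The list [:: (v1, w1); ...; (vn, wn)] stands for the formal sum
    v1 (x) w1 + ... + vn (x) wn. [tens_eq] is the smallest congruence for
    concatenation that makes concatenation commutative and (x) bilinear. *)
Inductive tens_eq : seq (V * W) -> seq (V * W) -> Prop :=
| tens_eq_refl s : tens_eq s s
| tens_eq_sym s t : tens_eq s t -> tens_eq t s
| tens_eq_trans t s u : tens_eq s t -> tens_eq t u -> tens_eq s u
| tens_eq_cat s s' t t' :
    tens_eq s s' -> tens_eq t t' -> tens_eq (s ++ t) (s' ++ t')
| tens_eq_catC s t : tens_eq (s ++ t) (t ++ s)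
| tens_eq_Dl v v' w : tens_eq [:: (v + v', w)] [:: (v, w); (v', w)]
| tens_eq_Dr v w w' : tens_eq [:: (v, w + w')] [:: (v, w); (v, w')]
| tens_eq_Z a v w : tens_eq [:: (a *: v, w)] [:: (v, a *: w)]
| tens_eq_0 w : tens_eq [:: (0, w)] [::].

Definition tens_rel (s t : seq (V * W)) : bool := `[< tens_eq s t >].

Lemma tens_relP s t : reflect (tens_eq s t) (tens_rel s t).
Proof. exact: asboolP. Qed.

Lemma tens_rel_refl : reflexive tens_rel.
Proof. by move=> s; apply/tens_relP; apply: tens_eq_refl. Qed.

Lemma tens_rel_sym : symmetric tens_rel.
Proof.
by move=> s t; apply/tens_relP/tens_relP => h; apply: tens_eq_sym.
Qed.

Lemma tens_rel_trans : transitive tens_rel.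
Proof.
move=> t s u /tens_relP st /tens_relP tu; apply/tens_relP.
exact: tens_eq_trans st tu.
Qed.

Canonical tens_equiv := EquivRel tens_rel tens_rel_refl tens_rel_sym
                                 tens_rel_trans.

Definition tens : Type := {eq_quot tens_rel}.
HB.instance Definition _ := Choice.copy tens {eq_quot tens_rel}.

Implicit Types (s t u : seq (V * W)) (x y z : tens).

Definition tens_of (s : seq (V * W)) : tens := \pi_{eq_quot tens_rel} s.
Definition tens_repr (x : tens) : seq (V * W) :=
  repr (x : {eq_quot tens_rel}).

Lemma tens_ofP s t : tens_eq s t <-> tens_of s = tens_of t.
Proof.
by split=> [h|/eqquotP/tens_relP//]; apply/eqquotP/tens_relP.
Qed.

Lemma tens_reprK x : tens_of (tens_repr x) = x. Proof. exact: reprK. Qed.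

Lemma tens_of_surj x : exists s, x = tens_of s.
Proof. by exists (tens_repr x); rewrite tens_reprK. Qed.

Lemma tens_repr_of s : tens_eq (tens_repr (tens_of s)) s.
Proof. by apply/tens_ofP; rewrite tens_reprK. Qed.

Definition tens_add x y : tens := tens_of (tens_repr x ++ tens_repr y).
Definition tens_opp x : tens :=
  tens_of [seq (- p.1, p.2) | p <- tens_repr x].
Definition tens_scale a x : tens :=
  tens_of [seq (a *: p.1, p.2) | p <- tens_repr x].

Lemma tens_map_eq (g : {linear V -> V}) s t : tens_eq s t ->
  tens_eq [seq (g p.1, p.2) | p <- s] [seq (g p.1, p.2) | p <- t].
Proof.
elim=> {s t} /=.
- by move=> s; apply: tens_eq_refl.
- by move=> s t _; apply: tens_eq_sym.
- by move=> s t u; move=> _ h _; apply: tens_eq_trans h.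
- by move=> s s' t t' _ h1 _ h2; rewrite !map_cat; apply: tens_eq_cat.
- by move=> s t; rewrite !map_cat; apply: tens_eq_catC.
- by move=> v v' w; rewrite linearD; apply: tens_eq_Dl.
- by move=> v w w'; apply: tens_eq_Dr.
- by move=> a v w; rewrite linearZ; apply: tens_eq_Z.
- by move=> w; rewrite linear0; apply: tens_eq_0.
Qed.

Lemma tens_addE s t : tens_add (tens_of s) (tens_of t) = tens_of (s ++ t).
Proof. by apply/tens_ofP; apply: tens_eq_cat; apply: tens_repr_of. Qed.

Lemma tens_oppE s :
  tens_opp (tens_of s) = tens_of [seq (- p.1, p.2) | p <- s].
Proof. exact/tens_ofP/(tens_map_eq -%R)/tens_repr_of. Qed.

Lemma tens_scaleE a s :
  tens_scale a (tens_of s) = tens_of [seq (a *: p.1, p.2) | p <- s].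
Proof. exact/tens_ofP/(tens_map_eq ( *:%R a))/tens_repr_of. Qed.

Lemma tens_addA : associative tens_add.
Proof.
move=> x y z; have [[s ->] [t ->] [u ->]] :=
  And3 (tens_of_surj x) (tens_of_surj y) (tens_of_surj z).
rewrite (tens_addE t) (tens_addE s (t ++ u)) (tens_addE s t).
by rewrite (tens_addE (s ++ t)) catA.
Qed.

Lemma tens_addC : commutative tens_add.
Proof. by move=> x y; apply/tens_ofP; apply: tens_eq_catC. Qed.

Lemma tens_add0 : left_id (tens_of [::]) tens_add.
Proof. by move=> x; have [s ->] := tens_of_surj x; rewrite tens_addE. Qed.

Lemma tens_addN : left_inverse (tens_of [::]) tens_opp tens_add.
Proof.
move=> x; have [s ->] := tens_of_surj x; rewrite tens_oppE tens_addE.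
elim: s => [|[v w] s IHs] //=.
set s' := map _ _ in IHs *.
have vw0 : tens_of [:: (- v, w); (v, w)] = tens_of [::].
  apply/tens_ofP; apply: tens_eq_trans (tens_eq_0 w).
  by apply: tens_eq_sym; rewrite -[X in tens_eq [:: (X, _)]](addNr v);
     apply: tens_eq_Dl.
transitivity (tens_add (tens_of [:: (- v, w)]) (tens_add (tens_of s')
    (tens_add (tens_of [:: (v, w)]) (tens_of s)))).
  by rewrite (tens_addE [:: (v, w)]) (tens_addE s') (tens_addE [:: _]).
rewrite (tens_addA (tens_of s')) (tens_addC (tens_of s')) -tens_addA.
rewrite (tens_addE s' s) IHs tens_addA (tens_addE [:: _] [:: _]) vw0.
exact: tens_add0.
Qed.

HB.instance Definition _ :=
  GRing.isZmodule.Build tens tens_addA tens_addC tens_add0 tens_addN.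

Lemma tens_scaleA a b x : tens_scale a (tens_scale b x) = tens_scale (a * b) x.
Proof.
have [s ->] := tens_of_surj x; rewrite !tens_scaleE -map_comp; congr tens_of.
by apply: eq_map => p /=; rewrite scalerA.
Qed.

Lemma tens_scale1 : left_id 1 tens_scale.
Proof.
move=> x; have [s ->] := tens_of_surj x; rewrite tens_scaleE.
by congr tens_of; rewrite -[RHS]map_id; apply: eq_map => -[v w] /=;
   rewrite scale1r.
Qed.

Lemma tens_scaleDr : right_distributive tens_scale +%R.
Proof.
move=> a x y; have [[s ->] [t ->]] := conj (tens_of_surj x) (tens_of_surj y).
by rewrite /+%R /= tens_addE !tens_scaleE tens_addE map_cat.
Qed.

Lemma tens_scaleDl x : {morph tens_scale^~ x : a b / a + b}.
Proof.
move=> a b; have [s ->] := tens_of_surj x; rewrite !tens_scaleE.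
have E p l : tens_of (p :: l) = tens_of [:: p] + tens_of l :> tens.
  by rewrite [RHS](tens_addE [:: p]).
elim: s => [|[v w] s IHs] /=; first by rewrite [RHS](tens_addE [::]).
rewrite !(E _ [seq _ | _ <- s]) IHs addrACA; congr (_ + _).
by rewrite scalerDl [RHS]tens_addE; apply/tens_ofP; exact: tens_eq_Dl.
Qed.

HB.instance Definition _ := GRing.Zmodule_isLmodule.Build k tens
  tens_scaleA tens_scale1 tens_scaleDr tens_scaleDl.

Definition tensor (v : V) (w : W) : tens := tens_of [:: (v, w)].

End TensorProduct.

Notation "V ⊗ W" := (tens V W) (at level 40, left associativity) : type_scope.
Notation "v ⊗ w" := (tensor v w) (at level 40, left associativity) : ring_scope.

Section LinearProp.
Variables (k : fieldType) (U M : lmodType k) (f : U -> M).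
Hypothesis lf : linear f.

Lemma linear_pD x y : f (x + y) = f x + f y.
Proof. by have := lf 1 x y; rewrite !scale1r. Qed.

Lemma linear_p0 : f 0 = 0.
Proof.
by have := linear_pD 0 0; rewrite addr0 -[X in X = _]addr0 => /addrI.
Qed.

Lemma linear_pZ a x : f (a *: x) = a *: f x.
Proof. by have := lf a x 0; rewrite linear_p0 !addr0. Qed.

End LinearProp.

Section TensorTheory.
Variables (k : fieldType) (V W : lmodType k).
Implicit Types (v : V) (w : W) (x : (V ⊗ W)%type).

Lemma tens_of_sum (s : seq (V * W)) : tens_of s = \sum_(p <- s) p.1 ⊗ p.2.
Proof.
elim: s => [|[v w] s IHs]; first by rewrite big_nil.
by rewrite big_cons -IHs -cat1s -tens_addE.
Qed.

Lemma tensorDl w : {morph (fun v => v ⊗ w) : v v' / v + v'}.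
Proof.
by move=> v v'; rewrite [RHS]tens_addE; apply/tens_ofP/tens_eq_Dl.
Qed.

Lemma tensorDr v : {morph (fun w => v ⊗ w) : w w' / w + w'}.
Proof.
by move=> w w'; rewrite [RHS]tens_addE; apply/tens_ofP/tens_eq_Dr.
Qed.

Lemma tensorZl a v w : (a *: v) ⊗ w = a *: (v ⊗ w).
Proof. by rewrite [RHS]tens_scaleE. Qed.

Lemma tensorZr a v w : v ⊗ (a *: w) = a *: (v ⊗ w).
Proof.
by rewrite -tensorZl; apply/tens_ofP/tens_eq_sym/tens_eq_Z.
Qed.

Lemma tensor_linearl w : linear (fun v => v ⊗ w).
Proof. by move=> a v v'; rewrite tensorDl tensorZl. Qed.

Lemma tensor_linearr v : linear (fun w => v ⊗ w).
Proof. by move=> a w w'; rewrite tensorDr tensorZr. Qed.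

Lemma tens_ind (P : (V ⊗ W)%type -> Prop) :
  P 0 -> (forall v w, P (v ⊗ w)) -> (forall x y, P x -> P y -> P (x + y)) ->
  forall x, P x.
Proof.
move=> P0 Pt PD x; have [s ->] := tens_of_surj x; rewrite tens_of_sum.
by apply: (big_ind P).
Qed.

(** The linear map V ⊗ W -> M with v ⊗ w |-> f v w. The value does not depend
    on the chosen representative when f is bilinear, see [tens_liftE]. *)
Definition tens_lift (M : lmodType k) (f : V -> W -> M) (x : (V ⊗ W)%type) : M :=
  \sum_(p <- tens_repr x) f p.1 p.2.

Section Lift.
Variables (M : lmodType k) (f : V -> W -> M).
Hypothesis fl : forall w, linear (f^~ w).
Hypothesis fr : forall v, linear (f v).

Lemma tens_lift_of s : tens_lift f (tens_of s) = \sum_(p <- s) f p.1 p.2.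
Proof.
suff fE s' t' : tens_eq s' t' ->
    \sum_(p <- s') f p.1 p.2 = \sum_(p <- t') f p.1 p.2.
  exact: (fE _ _ (tens_repr_of s)).
elim=> {s s' t'} //.
- by move=> s t u _ -> _ ->.
- by move=> s s' t t' _ h _ h'; rewrite !big_cat /= h h'.
- by move=> s t; rewrite !big_cat /= addrC.
- by move=> v v' w; rewrite !big_cons !big_nil !addr0 (linear_pD (fl _)).
- by move=> v w w'; rewrite !big_cons !big_nil !addr0 (linear_pD (fr _)).
- move=> a v w; rewrite !big_cons !big_nil !addr0 /=.
  by rewrite (linear_pZ (fl _)) (linear_pZ (fr _)).
- by move=> w; rewrite big_cons !big_nil addr0 (linear_p0 (fl _)).
Qed.

Lemma tens_liftE v w : tens_lift f (v ⊗ w) = f v w.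
Proof. by rewrite tens_lift_of big_cons big_nil addr0. Qed.

Lemma tens_lift_linear : linear (tens_lift f).
Proof.
move=> a x y; have [[s ->] [t ->]] := conj (tens_of_surj x) (tens_of_surj y).
rewrite [a *: _]tens_scaleE [_ + _]tens_addE !tens_lift_of big_cat big_map /=.
congr (_ + _); rewrite scaler_sumr; apply: eq_bigr => p _ /=.
by rewrite (linear_pZ (fl _)).
Qed.

End Lift.

Lemma tens_ext (M : lmodType k) (f g : (V ⊗ W)%type -> M) :
  linear f -> linear g -> (forall v w, f (v ⊗ w) = g (v ⊗ w)) -> f =1 g.
Proof.
move=> lf lg fg; apply: tens_ind => [|//|x y fgx fgy].
  by rewrite !linear_p0.
by rewrite !linear_pD // fgx fgy.
Qed.

End TensorTheory.


Lemma exists_linear_form (k : fieldType) (V : lmodType k) (v0 : V) :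
  v0 != 0 -> exists2 f : V -> k^o, linear f & f v0 = 1.
Proof.
move=> v0N0.
pose P (U : V -> Prop) :=
  ~ U v0 /\ forall a x y, U x -> U y -> U (a *: x + y).
have [F FP Fch|U [[Uv0 UP] Umax]] := @classical_sets.Zorn_bigcup V P.
  split=> [[X FX Xv0]|a x y [X FX Xx] [Y FY Yy]].
    by have [] := FP _ FX.
  have [XY|YX] := Fch _ _ FX FY.
    by exists Y => //; have [_] := FP _ FY; apply => //; apply: XY.
  by exists X => //; have [_] := FP _ FX; apply => //; apply: YX.
have {}Umax (B : V -> Prop) : (forall x, U x -> B x) -> P B ->
    forall x, B x -> U x.
  move=> UB PB x Bx; apply: contrapT => nUx.
  by apply: (Umax B) => //; split=> // BU; apply: nUx; apply: BU.
have U0 : U 0.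
  apply: contrapT => nU0.
  have Ue x : ~ U x.
    by move=> Ux; apply: nU0; rewrite -(addNr x) -scaleN1r; apply: UP.
  apply: nU0; apply: (Umax (fun x => x = 0)) => // [x /Ue //|].
  by split=> [/eqP|a x y -> ->]; rewrite ?(negPf v0N0) // scaler0 addr0.
have UZ a x : U x -> U (a *: x) by move=> Ux; rewrite -[_ *: _]addr0; apply: UP.
have UD x y : U x -> U y -> U (x + y).
  by move=> Ux Uy; rewrite -[x]scale1r; apply: UP.
have ex v : exists c : k^o, U (v - c *: v0).
  have [Uv|nUv] := pselect (U v); first by exists 0; rewrite scale0r subr0.
  have [[u [c [Uu e]]]|nv0] := pselect (exists u c, U u /\ v0 = u + c *: v).
    have c0 : c != 0.
      by apply/eqP => c0; apply: Uv0; rewrite e c0 scale0r addr0.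
    exists c^-1; rewrite e scalerDr scalerA mulVf // scale1r opprD addrCA subrr.
    by rewrite addr0 -scaleNr; apply: UZ.
  case: nUv; apply: (Umax (fun x => exists u c, U u /\ x = u + c *: v)).
  - by move=> x Ux; exists x, 0; rewrite scale0r addr0.
  - split=> // a _ _ [u [c [Uu ->]]] [u' [c' [Uu' ->]]].
    exists (a *: u + u'), (a * c + c'); split; first exact: UP.
    by rewrite scalerDr scalerA addrACA scalerDl.
  - by exists 0, 1; rewrite scale1r add0r.
have un v (c d : k) : U (v - c *: v0) -> U (v - d *: v0) -> c = d.
  move=> Uc Ud; apply/eqP; rewrite eq_sym -subr_eq0; apply/negPn/negP => cd.
  apply: Uv0; rewrite -[v0]scale1r -(mulVf cd) -scalerA; apply: (UZ).
  rewrite scalerBl; have -> : d *: v0 - c *: v0 =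
      (v - c *: v0) + -1 *: (v - d *: v0).
    by rewrite scaleN1r opprB [RHS]addrC addrA subrK.
  by apply: UD => //; apply: UZ.
have [f fP] := choice ex.
exists f; last by apply: (un v0) => //; rewrite scale1r subrr.
move=> a x y; apply: (un (a *: x + y)) => //.
rewrite scalerDl -scalerA opprD addrACA -scalerBr.
exact: UP.
Qed.

Section TensorAlgebra.
Variables (k : fieldType) (A B : algType k).
Implicit Types (a : A) (b : B) (x y z : (A ⊗ B)%type).

(** (a ⊗ b) (a' ⊗ b') = (a a') ⊗ (b b'), see [tensorM]. *)
Definition tens_mul x y : (A ⊗ B)%type :=
  tens_lift (fun a b => tens_lift (fun a' b' => (a * a') ⊗ (b * b')) y) x.

Let mul_fl a b b' : linear (fun a' => (a * a') ⊗ (b * b')).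
Proof. by move=> c a1 a2; rewrite mulrDr -scalerAr tensor_linearl. Qed.

Let mul_fr a b a' : linear (fun b' => (a * a') ⊗ (b * b')).
Proof. by move=> c b1 b2; rewrite mulrDr -scalerAr tensor_linearr. Qed.

Let mul_lin a b : linear (tens_lift (fun a' b' => (a * a') ⊗ (b * b'))).
Proof. exact: tens_lift_linear. Qed.

Let mul_linl y b :
  linear (fun a => tens_lift (fun a' b' => (a * a') ⊗ (b * b')) y).
Proof.
move=> c a1 a2; move: y.
apply: tens_ind => [|a' b'|y1 y2 h1 h2].
- by rewrite !(linear_p0 (mul_lin _ _)) scaler0 addr0.
- by rewrite !tens_liftE // mulrDl -scalerAl tensor_linearl.
- by rewrite !(linear_pD (mul_lin _ _)) h1 h2 scalerDr addrACA.
Qed.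

Let mul_linr y a :
  linear (fun b => tens_lift (fun a' b' => (a * a') ⊗ (b * b')) y).
Proof.
move=> c b1 b2; move: y.
apply: tens_ind => [|a' b'|y1 y2 h1 h2].
- by rewrite !(linear_p0 (mul_lin _ _)) scaler0 addr0.
- by rewrite !tens_liftE // mulrDl -scalerAl tensor_linearr.
- by rewrite !(linear_pD (mul_lin _ _)) h1 h2 scalerDr addrACA.
Qed.

Let tens_mul_linl y : linear (tens_mul^~ y).
Proof. by apply: tens_lift_linear. Qed.

Let tens_mulE a b a' b' :
  tens_mul (a ⊗ b) (a' ⊗ b') = (a * a') ⊗ (b * b').
Proof. by rewrite /tens_mul !tens_liftE. Qed.

Let tens_mul_linr x : linear (tens_mul x).
Proof.
move=> c y1 y2; move: x; apply: tens_ind => [|a b|x1 x2 h1 h2].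
- by rewrite !(linear_p0 (tens_mul_linl _)) scaler0 addr0.
- by rewrite /tens_mul !tens_liftE // mul_lin.
- by rewrite !(linear_pD (tens_mul_linl _)) h1 h2 scalerDr addrACA.
Qed.

Let mulDl : left_distributive tens_mul +%R.
Proof. by move=> x y z; rewrite (linear_pD (tens_mul_linl z)). Qed.

Let mulDr : right_distributive tens_mul +%R.
Proof. by move=> x y z; rewrite (linear_pD (tens_mul_linr x)). Qed.

Let mul0 x : tens_mul 0 x = 0.
Proof. exact: (linear_p0 (tens_mul_linl x)). Qed.

Let mulx0 x : tens_mul x 0 = 0.
Proof. exact: (linear_p0 (tens_mul_linr x)). Qed.

Let tens_mulA : associative tens_mul.
Proof.
move=> x y z; move: x; apply: tens_ind => [|a b|x1 x2 h1 h2].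
- by rewrite !mul0.
- move: y; apply: tens_ind => [|a' b'|y1 y2 h1 h2].
  + by rewrite mulx0 !mul0 mulx0.
  + move: z; apply: tens_ind => [|a'' b''|z1 z2 h1 h2].
    * by rewrite !mulx0.
    * by rewrite !tens_mulE !mulrA.
    * by rewrite !mulDr h1 h2.
  + by rewrite mulDl !mulDr mulDl h1 h2.
- by rewrite !mulDl h1 h2.
Qed.

Let tens_mul1 : left_id (1 ⊗ 1) tens_mul.
Proof.
apply: tens_ind => [|a b|x y h1 h2].
- exact: mulx0.
- by rewrite tens_mulE !mul1r.
- by rewrite mulDr h1 h2.
Qed.

Let tens_mulx1 : right_id (1 ⊗ 1) tens_mul.
Proof.
apply: tens_ind => [|a b|x y h1 h2].
- exact: mul0.
- by rewrite tens_mulE !mulr1.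
- by rewrite mulDl h1 h2.
Qed.

Let tens_1_neq0 : 1 ⊗ 1 != 0 :> (A ⊗ B)%type.
Proof.
have [f lf f1] := exists_linear_form (oner_neq0 A).
have [g lg g1] := exists_linear_form (oner_neq0 B).
have hl b : linear (fun a => f a * g b : k^o).
  by move=> c a a'; rewrite lf mulrDl -scalerAl.
have hr a : linear (fun b => f a * g b : k^o).
  by move=> c b b'; rewrite lg mulrDr -scalerAr.
apply/eqP => e.
have := tens_liftE hl hr 1 1; rewrite e (linear_p0 (tens_lift_linear hl hr)).
by rewrite f1 g1 mulr1 => /esym/eqP; rewrite oner_eq0.
Qed.

HB.instance Definition _ := GRing.Zmodule_isNzRing.Build (A ⊗ B)%type
  tens_mulA tens_mul1 tens_mulx1 mulDl mulDr tens_1_neq0.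

Lemma tensorM a b a' b' : (a ⊗ b) * (a' ⊗ b') = (a * a') ⊗ (b * b').
Proof. exact: tens_mulE. Qed.

Lemma tensor11 : 1 ⊗ 1 = 1 :> (A ⊗ B)%type. Proof. by []. Qed.

Let scaleAl c x y : c *: (x * y) = c *: x * y.
Proof. by rewrite [RHS](linear_pZ (tens_mul_linl y)). Qed.

HB.instance Definition _ :=
  GRing.Lmodule_isLalgebra.Build k (A ⊗ B)%type scaleAl.

Let scaleAr c x y : c *: (x * y) = x * (c *: y).
Proof. by rewrite [RHS](linear_pZ (tens_mul_linr x)). Qed.

HB.instance Definition _ :=
  GRing.Lalgebra_isAlgebra.Build k (A ⊗ B)%type scaleAr.

End TensorAlgebra.

Section ClassicalInverse.
Variable A : nzRingType.

Definition classic_unit (x : A) : bool :=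
  `[< exists y, y * x = 1 /\ x * y = 1 >].

Definition classic_inv (x : A) : A :=
  if pselect (exists y, y * x = 1 /\ x * y = 1) is left xU
  then projT1 (cid xU) else x.

Lemma classic_mulVr : {in classic_unit, left_inverse 1 classic_inv *%R}.
Proof.
move=> x /asboolP xU; rewrite /classic_inv; case: pselect => // {}xU.
by case: cid => y [].
Qed.

Lemma classic_mulrV : {in classic_unit, right_inverse 1 classic_inv *%R}.
Proof.
move=> x /asboolP xU; rewrite /classic_inv; case: pselect => // {}xU.
by case: cid => y [].
Qed.

Lemma classic_unitP (x y : A) : y * x = 1 /\ x * y = 1 -> classic_unit x.
Proof. by move=> xy; apply/asboolP; exists y. Qed.

Lemma classic_inv_out : {in [predC classic_unit], classic_inv =1 id}.
Proof.
by move=> x /asboolP xU; rewrite /classic_inv; case: pselect.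
Qed.

End ClassicalInverse.

HB.instance Definition _ (k : fieldType) (A B : algType k) :=
  GRing.NzRing_hasMulInverse.Build (A ⊗ B)%type
    (@classic_mulVr (A ⊗ B)%type) (@classic_mulrV (A ⊗ B)%type)
    (@classic_unitP (A ⊗ B)%type) (@classic_inv_out (A ⊗ B)%type).

(** * Formal power series *)

Record fps (A : Type) := FPS { fps_coef : nat -> A }.

Notation "A [[ħ]]" := (fps A) (at level 2, format "A [[ħ]]") : type_scope.

Definition fps_map (A B : Type) (f : A -> B) (s : fps A) : fps B :=
  FPS (fun n => f (fps_coef s n)).

Lemma fpsP (A : Type) (s t : fps A) :
  (forall n, fps_coef s n = fps_coef t n) -> s = t.
Proof. by case: s t => [s] [t] /= /funext ->. Qed.

HB.instance Definition _ (A : Type) := gen_eqMixin (fps A).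
HB.instance Definition _ (A : Type) := gen_choiceMixin (fps A).

Section FpsZmodule.
Variable A : zmodType.
Implicit Types s t u : fps A.

Definition fps_zero : fps A := FPS (fun=> 0).
Definition fps_opp s := FPS (fun n => - fps_coef s n).
Definition fps_add s t := FPS (fun n => fps_coef s n + fps_coef t n).

Let addA : associative fps_add.
Proof. by move=> s t u; apply/fpsP => n /=; rewrite addrA. Qed.
Let addC : commutative fps_add.
Proof. by move=> s t; apply/fpsP => n /=; rewrite addrC. Qed.
Let add0 : left_id fps_zero fps_add.
Proof. by move=> s; apply/fpsP => n /=; rewrite add0r. Qed.
Let addN : left_inverse fps_zero fps_opp fps_add.
Proof. by move=> s; apply/fpsP => n /=; rewrite addNr. Qed.

HB.instance Definition _ := GRing.isZmodule.Build (fps A) addA addC add0 addN.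

End FpsZmodule.

Section FpsRing.
Variable A : nzRingType.
Implicit Types s t u : fps A.

Definition fpsC (a : A) : fps A := FPS (fun n => if n == 0%N then a else 0).
Definition fpsX : fps A := FPS (fun n => (n == 1%N)%:R).
Definition fps_mul s t : fps A :=
  FPS (fun n => \sum_(i < n.+1) fps_coef s i * fps_coef t (n - i)%N).

Let T n s : {poly A} := \poly_(i < n.+1) fps_coef s i.

Let mulT n m s t : (m <= n)%N -> fps_coef (fps_mul s t) m = (T n s * T n t)`_m.
Proof.
move=> mn; rewrite coefM; apply: eq_bigr => i _; rewrite !coef_poly.
by rewrite !ltnS (leq_trans (leq_ord i) mn) (leq_trans (leq_subr _ _) mn).
Qed.

Let mulA : associative fps_mul.
Proof.
move=> s t u; apply/fpsP => n.
transitivity ((T n s * (T n t * T n u))`_n).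
  rewrite coefM; apply: eq_bigr => i _.
  by rewrite coef_poly ltn_ord -mulT // leq_subr.
rewrite mulrA coefM; apply: eq_bigr => i _.
by rewrite coef_poly ltnS leq_subr -mulT // leq_ord.
Qed.

Let mul1 : left_id (fpsC 1) fps_mul.
Proof.
move=> s; apply/fpsP => n /=.
rewrite big_ord_recl /= mul1r subn0 big1 ?addr0 // => i _.
by rewrite mul0r.
Qed.

Let mulx1 : right_id (fpsC 1) fps_mul.
Proof.
move=> s; apply/fpsP => n /=.
rewrite big_ord_recr /= subnn mulr1 big1 ?add0r // => i _.
by rewrite subn_eq0 leqNgt ltn_ord /= mulr0.
Qed.

Let mulDl : left_distributive fps_mul +%R.
Proof.
move=> s t u; apply/fpsP => n /=; rewrite -big_split.
by apply: eq_bigr => i _; rewrite mulrDl.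
Qed.

Let mulDr : right_distributive fps_mul +%R.
Proof.
move=> s t u; apply/fpsP => n /=; rewrite -big_split.
by apply: eq_bigr => i _; rewrite mulrDr.
Qed.

Let one_neq0 : fpsC 1 != 0.
Proof.
by apply/eqP => /(congr1 (@fps_coef A ^~ 0%N))/eqP; rewrite /= oner_eq0.
Qed.

HB.instance Definition _ := GRing.Zmodule_isNzRing.Build (fps A)
  mulA mul1 mulx1 mulDl mulDr one_neq0.

HB.instance Definition _ := GRing.NzRing_hasMulInverse.Build (fps A)
  (@classic_mulVr (fps A)) (@classic_mulrV (fps A))
  (@classic_unitP (fps A)) (@classic_inv_out (fps A)).

End FpsRing.

(** exp s = \sum_m s ^+ m / m!, for s without constant term: then s ^+ m has
    no terms of degree < m, so that the sum may be truncated at m <= n when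
    computing the coefficient of degree n. *)
Definition fps_exp (k : fieldType) (A : algType k) (s : fps A) : fps A :=
  FPS (fun n => \sum_(m < n.+1) (m`!%:R)^-1 *: fps_coef (s ^+ m) n).

(** * Bialgebras *)

Section TensorMaps.
Variable k : fieldType.

Definition tens_map (V V' W W' : lmodType k) (f : V -> V') (g : W -> W') :
    (V ⊗ W)%type -> (V' ⊗ W')%type :=
  tens_lift (fun v w => f v ⊗ g w).

Definition tens_flip (V W : lmodType k) : (V ⊗ W)%type -> (W ⊗ V)%type :=
  tens_lift (fun v w => w ⊗ v).

Definition tens_assoc (U V W : lmodType k) :
    (U ⊗ (V ⊗ W))%type -> (U ⊗ V ⊗ W)%type :=
  tens_lift (fun u => tens_lift (fun v w => u ⊗ v ⊗ w)).

Lemma tens_mapE (V V' W W' : lmodType k)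
    (f : {linear V -> V'}) (g : {linear W -> W'}) v w :
  tens_map f g (v ⊗ w) = f v ⊗ g w.
Proof.
rewrite /tens_map tens_liftE // => [w'|v'] a x y.
  by rewrite linearP tensor_linearl.
by rewrite linearP tensor_linearr.
Qed.

Lemma tens_flipE (V W : lmodType k) (v : V) (w : W) :
  tens_flip (v ⊗ w) = w ⊗ v.
Proof.
by rewrite /tens_flip tens_liftE // => [w'|v']; [apply: tensor_linearr|
  apply: tensor_linearl].
Qed.

Lemma tens_assocE (U V W : lmodType k) (u : U) (v : V) (w : W) :
  tens_assoc (u ⊗ (v ⊗ w)) = u ⊗ v ⊗ w.
Proof.
have fl u' w' : linear (fun v' : V => u' ⊗ v' ⊗ w' : (U ⊗ V ⊗ W)%type).
  by move=> a x y; rewrite tensor_linearr tensor_linearl.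
have fr u' v' : linear (fun w' : W => u' ⊗ v' ⊗ w' : (U ⊗ V ⊗ W)%type).
  by move=> a x y; rewrite tensor_linearr.
rewrite /tens_assoc tens_liftE ?tens_liftE // => [x|u'].
  move=> a u1 u2; move: x; apply: tens_ind => [|v' w'|x y hx hy].
  - by rewrite !(linear_p0 (tens_lift_linear _ _)) // scaler0 addr0.
  - by rewrite !tens_liftE // tensor_linearl tensor_linearl.
  - rewrite !(linear_pD (tens_lift_linear _ _)) // hx hy.
    by rewrite scalerDr addrACA.
exact: tens_lift_linear.
Qed.

End TensorMaps.

Section Bialgebra.
Variables (k : fieldType) (H : algType k).

(** H ⊗ H ⊗ H is (H ⊗ H) ⊗ H; elements of H ⊗ (H ⊗ H) are moved there by
    [tens_assoc]. *)
Definition leg12 (A : (H ⊗ H)%type) : (H ⊗ H ⊗ H)%type := A ⊗ 1.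
Definition leg23 (A : (H ⊗ H)%type) : (H ⊗ H ⊗ H)%type := tens_assoc (1 ⊗ A).
Definition leg13 : (H ⊗ H)%type -> (H ⊗ H ⊗ H)%type :=
  tens_lift (fun a b => a ⊗ 1 ⊗ b).

Lemma leg13E a b : leg13 (a ⊗ b) = a ⊗ 1 ⊗ b.
Proof.
rewrite /leg13 tens_liftE // => [b'|a'] c x y.
  by rewrite tensor_linearl tensor_linearl.
by rewrite tensor_linearr.
Qed.

Definition commutator (A : nzRingType) (a b : A) : A := a * b - b * a.

Variables (Delta : {lrmorphism H -> (H ⊗ H)%type}) (eps : {lrmorphism H -> k^o}).

Definition Delta_op (x : H) : (H ⊗ H)%type := tens_flip (Delta x).
Definition Delta_id : (H ⊗ H)%type -> (H ⊗ H ⊗ H)%type :=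
  tens_map Delta idfun.
Definition id_Delta (A : (H ⊗ H)%type) : (H ⊗ H ⊗ H)%type :=
  tens_assoc (tens_map idfun Delta A).

Definition is_bialgebra : Prop :=
  [/\ forall x, Delta_id (Delta x) = id_Delta (Delta x),
      forall x, tens_lift (fun a b => (eps a : k) *: b) (Delta x) = x
    & forall x, tens_lift (fun a b => (eps b : k) *: a) (Delta x) = x].

Definition quasitriangular (R : (H ⊗ H)%type) : Prop :=
  [/\ R \is a GRing.unit,
      forall x, Delta_op x = R * Delta x * R^-1,
      id_Delta R = leg13 R * leg12 R
    & Delta_id R = leg13 R * leg23 R].

Definition pre_cartier (R chi : (H ⊗ H)%type) : Prop :=
  [/\ is_bialgebra,
      quasitriangular R,
      forall x, chi * Delta x = Delta x * chi,
      id_Delta chi = leg12 chi + (leg12 R)^-1 * leg13 chi * leg12 R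
    & Delta_id chi = leg23 chi + (leg23 R)^-1 * leg13 chi * leg23 R].

(** Quasitriangular structures on H[[ħ]]: its n-fold completed tensor power
    over k[[ħ]] is identified with (H ⊗ ... ⊗ H)[[ħ]], and the ħ-linear
    extension of a k-linear map f with [fps_map f]. *)
Definition fps_quasitriangular (R : (H ⊗ H)[[ħ]]%type) : Prop :=
  [/\ R \is a GRing.unit,
      forall x : H[[ħ]], fps_map Delta_op x = R * fps_map Delta x * R^-1,
      fps_map id_Delta R = fps_map leg13 R * fps_map leg12 R
    & fps_map Delta_id R = fps_map leg13 R * fps_map leg23 R].

End Bialgebra.

(* Main.v *)
From HB Require Import structures.
Require Import Defs.
From mathcomp Require Import all_boot all_order all_algebra.

Set Implicit Arguments.
Unset Strict Implicit.
Unset Printing Implicit Defensive.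

Import GRing.Theory.
Local Open Scope ring_scope.

(** Write χ12, R13, ... for the legs. Everything rests on one observation:
    the axioms say that χ12 commutes with the whole image of Δ ⊗ id, and χ23
    with the whole image of id ⊗ Δ ([leg12_comm_Delta_id],
    [leg23_comm_id_Delta]).

    Equivalence of the conditions. By the axioms, the image of Δ ⊗ id contains
    (Δ ⊗ id)(χ) = χ23 + R23^-1 χ13 R23 and (Δ ⊗ id)(R) = R13 R23. As χ12
    commutes with the first, it commutes with χ23 exactly when it commutes
    with R23^-1 χ13 R23, that is, when R23 χ12 R23^-1 commutes with χ13. As
    it commutes with the second, R23 χ12 R23^-1 = R13^-1 χ12 R13. So
    [χ12, χ23] = 0 means that χ13 commutes with R13^-1 χ12 R13, and exchanging
    the last two tensor factors turns this into
    [χ12, R12^-1 χ13 R12] = 0. The condition [χ23, R23^-1 χ13 R23] = 0 is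
    reached in the same way from χ23 and id ⊗ Δ, exchanging the first two
    factors. Both cases are instances of [comm_conj_transfer].

    Quasitriangularity. Put E(a) = exp(ħ a). An algebra map f sends E(a) to
    E(f a), conjugation by R sends E(a) to E(R a R^-1), and
    E(a + b) = E(a) E(b) as soon as a and b commute. Since χ commutes with
    the image of Δ, so does E(χ), and R E(χ) still intertwines Δ and Δ^op.
    In (id ⊗ Δ)(R E(χ)) = R13 R12 E(χ12 + R12^-1 χ13 R12) the two summands
    commute by hypothesis, so the exponential splits, and moving R12 through
    E(R12^-1 χ13 R12) yields R13 E(χ13) R12 E(χ12). The other hexagon is the
    same computation with R23 ([exp_hexagon]). *)

(** * Algebra maps between tensor products *)

Lemma commutator_eq0 (A : nzRingType) (a b : A) :
  commutator a b = 0 <-> GRing.comm a b.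
Proof. by rewrite /commutator; split=> [/subr0_eq | ->]; rewrite ?subrr. Qed.

Section TensorMorphism.
Variables (k : fieldType) (A B C : algType k) (F : (A ⊗ B)%type -> C).
Hypothesis lF : linear F.
Hypothesis F1 : F (1 ⊗ 1) = 1.
Hypothesis FM : forall a b a' b',
  F ((a * a') ⊗ (b * b')) = F (a ⊗ b) * F (a' ⊗ b').

(** Pure tensors span, so multiplicativity of a linear map is only to be
    tested on them. *)
Lemma tens_monoid_morphism : GRing.monoid_morphism F.
Proof.
split=> [|x y]; first exact: F1.
elim/tens_ind: x => [|a b|x1 x2 h1 h2].
- by rewrite mul0r (linear_p0 lF) mul0r.
- elim/tens_ind: y => [|a' b'|y1 y2 h1 h2].
  + by rewrite mulr0 (linear_p0 lF) mulr0.
  + by rewrite tensorM FM.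
  + by rewrite mulrDr !(linear_pD lF) h1 h2 mulrDr.
- by rewrite mulrDl !(linear_pD lF) h1 h2 mulrDl.
Qed.

End TensorMorphism.

Section TensMapMorphism.
Variables (k : fieldType) (A A' B B' : algType k).
Variables (f : {lrmorphism A -> A'}) (g : {lrmorphism B -> B'}).

Lemma tens_map_linear : linear (tens_map f g).
Proof.
by apply: tens_lift_linear => [b|a] c x y;
  rewrite linearP ?tensor_linearl ?tensor_linearr.
Qed.

Lemma tens_map_monoid_morphism : GRing.monoid_morphism (tens_map f g).
Proof.
apply: tens_monoid_morphism; first exact: tens_map_linear.
  by rewrite tens_mapE !rmorph1.
by move=> a b a' b'; rewrite !tens_mapE tensorM !rmorphM.
Qed.

End TensMapMorphism.

Section TensFlipMorphism.
Variables (k : fieldType) (A B : algType k).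

Lemma tens_flip_linear : linear (@tens_flip k A B).
Proof.
by apply: tens_lift_linear => [b|a];
  [apply: tensor_linearr | apply: tensor_linearl].
Qed.

Lemma tens_flip_monoid_morphism : GRing.monoid_morphism (@tens_flip k A B).
Proof.
apply: tens_monoid_morphism; first exact: tens_flip_linear.
  by rewrite tens_flipE.
by move=> a b a' b'; rewrite !tens_flipE tensorM.
Qed.

HB.instance Definition _ :=
  GRing.isLinear.Build k (A ⊗ B)%type (B ⊗ A)%type _ (@tens_flip k A B)
    tens_flip_linear.
HB.instance Definition _ :=
  GRing.isMonoidMorphism.Build (A ⊗ B)%type (B ⊗ A)%type (@tens_flip k A B)
    tens_flip_monoid_morphism.

End TensFlipMorphism.

Section TensAssocMorphism.
Variables (k : fieldType) (A B C : algType k).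

Lemma tens_assoc_inner_linear (a : A) :
  linear (tens_lift (fun (b : B) (c : C) => a ⊗ b ⊗ c)).
Proof.
apply: tens_lift_linear => [c|b] z x y; last by rewrite tensor_linearr.
by rewrite tensor_linearr tensor_linearl.
Qed.

Lemma tens_assoc_innerE (a : A) b c :
  tens_lift (fun (b : B) (c : C) => a ⊗ b ⊗ c) (b ⊗ c) = a ⊗ b ⊗ c.
Proof.
rewrite tens_liftE // => [c'|b'] z x y; last by rewrite tensor_linearr.
by rewrite tensor_linearr tensor_linearl.
Qed.

Lemma tens_assoc_linear : linear (@tens_assoc k A B C).
Proof.
apply: tens_lift_linear => [x|a]; last exact: tens_assoc_inner_linear.
move=> z a1 a2; elim/tens_ind: x => [|b c|x y hx hy].
- by rewrite !(linear_p0 (tens_assoc_inner_linear _)) scaler0 addr0.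
- by rewrite !tens_assoc_innerE !tensor_linearl.
- by rewrite !(linear_pD (tens_assoc_inner_linear _)) hx hy scalerDr addrACA.
Qed.

Lemma tens_assoc_monoid_morphism : GRing.monoid_morphism (@tens_assoc k A B C).
Proof.
have aD u := linear_pD tens_assoc_linear u.
have a0 := linear_p0 tens_assoc_linear.
have t0 (u : A) : u ⊗ 0 = 0 :> (A ⊗ (B ⊗ C))%type.
  exact: (linear_p0 (tensor_linearr u)).
apply: tens_monoid_morphism; first exact: tens_assoc_linear.
  by rewrite -(tensor11 B C) tens_assocE.
move=> u x u' y; elim/tens_ind: x => [|b c|x1 x2 h1 h2].
- by rewrite mul0r !t0 a0 mul0r.
- elim/tens_ind: y => [|b' c'|y1 y2 h1 h2].
  + by rewrite mulr0 !t0 a0 mulr0.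
  + by rewrite tensorM !tens_assocE !tensorM.
  + by rewrite mulrDr !tensorDr !aD h1 h2 mulrDr.
- by rewrite mulrDl !tensorDr !aD h1 h2 mulrDl.
Qed.

HB.instance Definition _ :=
  GRing.isLinear.Build k (A ⊗ (B ⊗ C))%type (A ⊗ B ⊗ C)%type _
    (@tens_assoc k A B C) tens_assoc_linear.
HB.instance Definition _ :=
  GRing.isMonoidMorphism.Build (A ⊗ (B ⊗ C))%type (A ⊗ B ⊗ C)%type
    (@tens_assoc k A B C) tens_assoc_monoid_morphism.

End TensAssocMorphism.

(** * Legs and exchanges of tensor factors *)

Section Legs.
Variables (k : fieldType) (H : algType k).
Implicit Types A : (H ⊗ H)%type.

Lemma leg12_linear : linear (@leg12 k H).
Proof. exact: tensor_linearl. Qed.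

Lemma leg12_monoid_morphism : GRing.monoid_morphism (@leg12 k H).
Proof. by split=> // x y; rewrite /leg12 tensorM mulr1. Qed.

HB.instance Definition _ :=
  GRing.isLinear.Build k (H ⊗ H)%type (H ⊗ H ⊗ H)%type _ (@leg12 k H)
    leg12_linear.
HB.instance Definition _ :=
  GRing.isMonoidMorphism.Build (H ⊗ H)%type (H ⊗ H ⊗ H)%type (@leg12 k H)
    leg12_monoid_morphism.

Lemma leg23_linear : linear (@leg23 k H).
Proof. by move=> c x y; rewrite /leg23 tensor_linearr linearP. Qed.

Lemma leg23_monoid_morphism : GRing.monoid_morphism (@leg23 k H).
Proof.
split=> [|x y]; first by rewrite /leg23 rmorph1.
by rewrite /leg23 -rmorphM tensorM mulr1.
Qed.

HB.instance Definition _ :=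
  GRing.isLinear.Build k (H ⊗ H)%type (H ⊗ H ⊗ H)%type _ (@leg23 k H)
    leg23_linear.
HB.instance Definition _ :=
  GRing.isMonoidMorphism.Build (H ⊗ H)%type (H ⊗ H ⊗ H)%type (@leg23 k H)
    leg23_monoid_morphism.

Lemma leg13_linear : linear (@leg13 k H).
Proof.
apply: tens_lift_linear => [b|a] c x y; last by rewrite tensor_linearr.
by rewrite !tensor_linearl.
Qed.

Lemma leg13_monoid_morphism : GRing.monoid_morphism (@leg13 k H).
Proof.
apply: tens_monoid_morphism; first exact: leg13_linear.
  by rewrite leg13E.
by move=> a b a' b'; rewrite !leg13E !tensorM mulr1.
Qed.

HB.instance Definition _ :=
  GRing.isLinear.Build k (H ⊗ H)%type (H ⊗ H ⊗ H)%type _ (@leg13 k H)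
    leg13_linear.
HB.instance Definition _ :=
  GRing.isMonoidMorphism.Build (H ⊗ H)%type (H ⊗ H ⊗ H)%type (@leg13 k H)
    leg13_monoid_morphism.

Lemma leg12E a b : leg12 (a ⊗ b : (H ⊗ H)%type) = a ⊗ b ⊗ 1.
Proof. by []. Qed.

Lemma leg23E a b : leg23 (a ⊗ b : (H ⊗ H)%type) = 1 ⊗ a ⊗ b.
Proof. exact: tens_assocE. Qed.

Definition swap12 : (H ⊗ H ⊗ H)%type -> (H ⊗ H ⊗ H)%type :=
  tens_map (@tens_flip k H H) idfun.

HB.instance Definition _ :=
  GRing.isLinear.Build k (H ⊗ H ⊗ H)%type (H ⊗ H ⊗ H)%type _ swap12
    (tens_map_linear (@tens_flip k H H) idfun).
HB.instance Definition _ :=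
  GRing.isMonoidMorphism.Build (H ⊗ H ⊗ H)%type (H ⊗ H ⊗ H)%type swap12
    (tens_map_monoid_morphism (@tens_flip k H H) idfun).

Lemma swap12E (a b c : H) : swap12 (a ⊗ b ⊗ c) = b ⊗ a ⊗ c.
Proof. by rewrite /swap12 tens_mapE /= tens_flipE. Qed.

Lemma swap12_leg13 A : swap12 (leg13 A) = leg23 A.
Proof.
move: A; apply: tens_ext => [c x y|c x y|a b]; rewrite ?linearP //.
by rewrite leg13E leg23E swap12E.
Qed.

Lemma swap12_leg23 A : swap12 (leg23 A) = leg13 A.
Proof.
move: A; apply: tens_ext => [c x y|c x y|a b]; rewrite ?linearP //.
by rewrite leg13E leg23E swap12E.
Qed.

(** The product form makes a ⊗ b ⊗ c |-> a ⊗ c ⊗ b visibly linear in the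
    element a ⊗ b of H ⊗ H, which need not be decomposed. *)
Definition swap23 : (H ⊗ H ⊗ H)%type -> (H ⊗ H ⊗ H)%type :=
  tens_lift (fun x c => leg13 x * (1 ⊗ c ⊗ 1)).

Let swap23_linl (c : H) : linear (fun x => leg13 x * (1 ⊗ c ⊗ 1)).
Proof. by move=> z x y; rewrite linearP mulrDl scalerAl. Qed.

Let swap23_linr (x : (H ⊗ H)%type) :
  linear (fun c : H => leg13 x * (1 ⊗ c ⊗ 1)).
Proof.
by move=> z b c; rewrite tensor_linearr tensor_linearl mulrDr scalerAr.
Qed.

Lemma swap23_linear : linear swap23.
Proof. exact: tens_lift_linear. Qed.

Lemma leg13_comm_middle A (c : H) : GRing.comm (leg13 A) (1 ⊗ c ⊗ 1).
Proof.
elim/tens_ind: A => [|a b|x y hx hy]; first by rewrite linear0; apply/commr_sym/commr0.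
  by rewrite /GRing.comm leg13E !tensorM !mul1r !mulr1.
by rewrite linearD; apply/commr_sym/commrD; apply: commr_sym.
Qed.

Lemma swap23_monoid_morphism : GRing.monoid_morphism swap23.
Proof.
apply: tens_monoid_morphism; first exact: swap23_linear.
  by rewrite /swap23 tens_liftE // rmorph1 mul1r.
move=> x c x' c'; rewrite /swap23 !tens_liftE // rmorphM.
rewrite -!mulrA; congr (_ * _).
rewrite [RHS]mulrA -(leg13_comm_middle x' c) -mulrA; congr (_ * _).
by rewrite !tensorM !mulr1.
Qed.

HB.instance Definition _ :=
  GRing.isLinear.Build k (H ⊗ H ⊗ H)%type (H ⊗ H ⊗ H)%type _ swap23
    swap23_linear.
HB.instance Definition _ :=
  GRing.isMonoidMorphism.Build (H ⊗ H ⊗ H)%type (H ⊗ H ⊗ H)%type swap23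
    swap23_monoid_morphism.

Lemma swap23E (a b c : H) : swap23 (a ⊗ b ⊗ c) = a ⊗ c ⊗ b.
Proof. by rewrite /swap23 tens_liftE // leg13E !tensorM !mulr1 mul1r. Qed.

Lemma swap23_leg12 A : swap23 (leg12 A) = leg13 A.
Proof.
move: A; apply: tens_ext => [c x y|c x y|a b]; rewrite ?linearP //.
by rewrite leg13E leg12E swap23E.
Qed.

Lemma swap23_leg13 A : swap23 (leg13 A) = leg12 A.
Proof.
move: A; apply: tens_ext => [c x y|c x y|a b]; rewrite ?linearP //.
by rewrite leg13E leg12E swap23E.
Qed.

Variable Delta : {lrmorphism H -> (H ⊗ H)%type}.

HB.instance Definition _ :=
  GRing.isLinear.Build k (H ⊗ H)%type (H ⊗ H ⊗ H)%type _ (Delta_id Delta)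
    (tens_map_linear Delta idfun).
HB.instance Definition _ :=
  GRing.isMonoidMorphism.Build (H ⊗ H)%type (H ⊗ H ⊗ H)%type (Delta_id Delta)
    (tens_map_monoid_morphism Delta idfun).

Lemma id_Delta_linear : linear (id_Delta Delta).
Proof. by move=> c x y; rewrite /id_Delta tens_map_linear linearP. Qed.

Lemma id_Delta_monoid_morphism : GRing.monoid_morphism (id_Delta Delta).
Proof.
have [m1 mM] := tens_map_monoid_morphism (@idfun H) Delta.
by split=> [|x y]; rewrite /id_Delta ?m1 ?rmorph1 ?mM ?rmorphM.
Qed.

HB.instance Definition _ :=
  GRing.isLinear.Build k (H ⊗ H)%type (H ⊗ H ⊗ H)%type _ (id_Delta Delta)
    id_Delta_linear.
HB.instance Definition _ :=
  GRing.isMonoidMorphism.Build (H ⊗ H)%type (H ⊗ H ⊗ H)%type (id_Delta Delta)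
    id_Delta_monoid_morphism.

Variable chi : (H ⊗ H)%type.
Hypothesis chiD : forall x, chi * Delta x = Delta x * chi.

(** On a pure tensor, (Δ ⊗ id)(a ⊗ b) = Δ a ⊗ b, and only the factor Δ a meets
    χ; [leg23_comm_id_Delta] is the mirror image. *)
Lemma leg12_comm_Delta_id A : GRing.comm (leg12 chi) (Delta_id Delta A).
Proof.
elim/tens_ind: A => [|a b|x y hx hy]; first by rewrite linear0; apply: commr0.
  rewrite /GRing.comm /leg12 /Delta_id tens_mapE !tensorM chiD.
  by rewrite mul1r mulr1.
by rewrite linearD; apply: commrD.
Qed.

Lemma leg23_comm_id_Delta A : GRing.comm (leg23 chi) (id_Delta Delta A).
Proof.
elim/tens_ind: A => [|a b|x y hx hy]; first by rewrite linear0; apply: commr0.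
  rewrite /GRing.comm /leg23 /id_Delta tens_mapE -!rmorphM !tensorM chiD.
  by rewrite mul1r mulr1.
by rewrite linearD; apply: commrD.
Qed.

End Legs.

(** * Equivalence of the three conditions *)

Lemma rmorph_comm_conj (A B : unitRingType) (f : {rmorphism A -> B})
    (r x y : A) :
  r \is a GRing.unit -> GRing.comm y (r^-1 * x * r) ->
  GRing.comm (f y) ((f r)^-1 * f x * f r).
Proof.
move=> Ur h; rewrite -(rmorphV f Ur) -!rmorphM /GRing.comm -!rmorphM.
by congr (f _).
Qed.

(** Commuting with z + r^-1 y r makes commuting with z the same as commuting
    with r^-1 y r; conjugating by r then moves the conjugation from y onto x,
    where r may be traded for s^-1 because x commutes with s r. *)
Lemma comm_conj_transfer (A : unitRingType) (x y z r s : A) :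
  r \is a GRing.unit -> s \is a GRing.unit ->
  GRing.comm x (z + r^-1 * y * r) -> GRing.comm x (s * r) ->
  GRing.comm x z <-> GRing.comm y (s^-1 * x * s).
Proof.
move=> Ur Us xw xsr.
have xE : s^-1 * x * s = r * x * r^-1.
  apply: (mulIr Ur); rewrite -(mulrA _ s) -[in LHS](mulrA s^-1) xsr !mulrA.
  by rewrite mulVr // mul1r divrK.
have xzE : GRing.comm x z <-> GRing.comm x (r^-1 * y * r).
  split=> h.
    rewrite (_ : r^-1 * y * r = (z + r^-1 * y * r) - z); first exact: commrB.
    by rewrite addrC addKr.
  rewrite (_ : z = (z + r^-1 * y * r) - r^-1 * y * r); first exact: commrB.
  by rewrite addrK.
rewrite xzE xE /GRing.comm; split=> h.
  have := congr1 (fun t => r * t * r^-1) h.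
  by rewrite !mulrA !mulrK // mulrV // mul1r => ->.
have UrV : r^-1 \is a GRing.unit by rewrite unitrV.
apply: (mulrI Ur); apply: (mulIr UrV).
by rewrite !mulrA mulrK // mulrV // mul1r -h !mulrA.
Qed.

(** * The exponential series exp(ħ a) *)

Section Exp.
Variables (k : fieldType).
Hypothesis char_k : [pchar k] =i pred0.

Definition exph (A : algType k) (a : A) : fps A := fps_exp (fpsX A * fpsC a).

Lemma fpsM_coef (A : nzRingType) (s t : fps A) n :
  fps_coef (s * t) n = \sum_(i < n.+1) fps_coef s i * fps_coef t (n - i)%N.
Proof. by []. Qed.

Lemma fpsX_coef (A : nzRingType) (s : fps A) n :
  fps_coef (fpsX A * s) n = if n is m.+1 then fps_coef s m else 0.
Proof.
case: n => [|n] /=; first by rewrite big_ord1 mul0r.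
rewrite big_ord_recl mul0r add0r big_ord_recl /= mul1r subSS subn0.
by rewrite big1 ?addr0 // => i _; rewrite mul0r.
Qed.

Lemma fpsCM_coef (A : nzRingType) (a : A) (s : fps A) n :
  fps_coef (fpsC a * s) n = a * fps_coef s n.
Proof.
rewrite /= big_ord_recl /= subn0 big1 ?addr0 // => i _.
by rewrite mul0r.
Qed.

Lemma fpsMC_coef (A : nzRingType) (a : A) (s : fps A) n :
  fps_coef (s * fpsC a) n = fps_coef s n * a.
Proof.
rewrite /= big_ord_recr /= subnn eqxx big1 ?add0r // => i _.
by rewrite subn_eq0 leqNgt ltn_ord mulr0.
Qed.

Lemma fpsXC_exp_coef (A : nzRingType) (a : A) m n :
  fps_coef ((fpsX A * fpsC a) ^+ m) n = if n == m then a ^+ m else 0.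
Proof.
elim: m n => [|m IHm] n; first by case: n.
rewrite exprS -mulrA fpsX_coef; case: n => [|n] //.
by rewrite fpsCM_coef IHm eqSS; case: eqP => _; rewrite ?mulr0 ?exprS.
Qed.

Lemma exph_coef (A : algType k) (a : A) n :
  fps_coef (exph a) n = (n`!%:R)^-1 *: a ^+ n.
Proof.
rewrite /= big_ord_recr /= fpsXC_exp_coef eqxx big1 ?add0r // => i _.
by rewrite fpsXC_exp_coef gtn_eqF ?ltn_ord // scaler0.
Qed.

(** In degree n this is the binomial formula divided by n!, the quotient
    'C(n, i) / n! being 1 / (i! (n - i)!) in characteristic zero. *)
Lemma exphD (A : algType k) (a b : A) :
  GRing.comm a b -> exph (a + b) = exph a * exph b.
Proof.
move=> ab; apply/fpsP => n; rewrite fpsM_coef exph_coef addrC.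
rewrite (exprDn_comm _ (commr_sym ab)) scaler_sumr.
have natN0 m : m`!%:R != 0 :> k.
  by rewrite (pcharf0P k).1 // -lt0n fact_gt0.
apply: eq_bigr => i _; rewrite !exph_coef -scalerAl -scalerAr scalerA.
have /(congr1 (fun m => m%:R : k)) := bin_fact (leq_ord i).
rewrite !natrM => binE.
have abi : GRing.comm (a ^+ i) (b ^+ (n - i)).
  exact/commrX/commr_sym/commrX/commr_sym.
rewrite -abi -scaler_nat scalerA; congr (_ *: _).
apply: (mulIf (natN0 n)); rewrite mulrAC mulVf // mul1r -binE.
by rewrite mulrCA mulrACA !mulVf // !mulr1.
Qed.

Lemma exph0 (A : algType k) : exph (0 : A) = 1.
Proof.
apply/fpsP => -[|n]; rewrite exph_coef; first by rewrite invr1 scale1r.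
by rewrite exprS mul0r scaler0.
Qed.

Lemma exph_unit (A : algType k) (a : A) : exph a \is a GRing.unit.
Proof.
apply/unitrP; exists (exph (- a)).
by rewrite -!exphD ?addNr ?subrr ?exph0 //; [apply: commrN|
  apply/commr_sym/commrN].
Qed.

Lemma fps_map_exph (A B : algType k) (f : {lrmorphism A -> B}) (a : A) :
  fps_map f (exph a) = exph (f a).
Proof.
apply/fpsP => n; rewrite exph_coef -[LHS]/(f (fps_coef (exph a) n)).
by rewrite exph_coef linearZ /= rmorphXn.
Qed.

Lemma fps_mapM (A B : nzRingType) (f : {rmorphism A -> B}) (s t : fps A) :
  fps_map f (s * t) = fps_map f s * fps_map f t.
Proof.
apply/fpsP => n /=; rewrite rmorph_sum.
by apply: eq_bigr => i _; rewrite rmorphM.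
Qed.

Lemma fps_mapC (A B : nzRingType) (f : {rmorphism A -> B}) (a : A) :
  fps_map f (fpsC a) = fpsC (f a).
Proof. by apply/fpsP => n /=; case: eqP => _ //; rewrite rmorph0. Qed.

Lemma fpsCM (A : nzRingType) (a b : A) : fpsC (a * b) = fpsC a * fpsC b.
Proof.
by apply/fpsP => n; rewrite fpsCM_coef /=; case: eqP; rewrite ?mulr0.
Qed.

Lemma fpsC_unit (A : unitRingType) (a : A) :
  a \is a GRing.unit -> fpsC a \is a GRing.unit.
Proof.
move=> Ua; apply/unitrP; exists (fpsC a^-1).
by rewrite -!fpsCM mulVr ?mulrV.
Qed.

Lemma fpsCV (A : unitRingType) (a : A) :
  a \is a GRing.unit -> (fpsC a)^-1 = fpsC a^-1.
Proof.
move=> Ua; apply: (mulrI (fpsC_unit Ua)).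
by rewrite divrr ?fpsC_unit // -fpsCM divrr.
Qed.

Lemma exph_comm_coef (A : algType k) (a : A) (s : fps A) :
  (forall n, GRing.comm a (fps_coef s n)) -> GRing.comm (exph a) s.
Proof.
move=> as_comm; apply/fpsP => n; rewrite !fpsM_coef.
rewrite [RHS](reindex_inj rev_ord_inj); apply: eq_bigr => i _.
rewrite (_ : nat_of_ord (rev_ord i) = n - i)%N ?subKn ?leq_ord //.
rewrite exph_coef -scalerAl -scalerAr.
by congr (_ *: _); apply/commr_sym/commrX/commr_sym.
Qed.

Lemma exph_conj (A : unitAlgType k) (r a : A) : r \is a GRing.unit ->
  fpsC r * exph (r^-1 * a * r) = exph a * fpsC r.
Proof.
move=> Ur; apply/fpsP => n; rewrite fpsCM_coef fpsMC_coef !exph_coef.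
rewrite -scalerAl -scalerAr; congr (_ *: _).
elim: n => [|n IHn]; first by rewrite !expr0 mulr1 mul1r.
by rewrite !exprS mulrA -[RHS]mulrA -IHn !mulrA mulrV // mul1r.
Qed.

(** With w = r^-1 y r commuting with x, exp(ħ(x + w)) = exp(ħw) exp(ħx), and
    r exp(ħw) = exp(ħy) r. *)
Lemma exp_hexagon (A : unitAlgType k) (s r x y : A) :
  r \is a GRing.unit -> GRing.comm x (r^-1 * y * r) ->
  fpsC (s * r) * exph (x + r^-1 * y * r) =
  (fpsC s * exph y) * (fpsC r * exph x).
Proof.
move=> Ur xw; rewrite addrC exphD; last exact: commr_sym.
by rewrite fpsCM -mulrA [fpsC r * _]mulrA exph_conj // !mulrA.
Qed.

End Exp.

(** * Quasitriangularity of R exp(ħ χ) *)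

Theorem theorem4p16 (k : fieldType) (char_k : [pchar k] =i pred0)
    (H : algType k) (Delta : {lrmorphism H -> (H ⊗ H)%type})
    (eps : {lrmorphism H -> k^o}) (R chi : (H ⊗ H)%type)
    (Hpc : pre_cartier Delta eps R chi) :
  let C1 := commutator (leg12 chi)
              ((leg12 R)^-1 * leg13 chi * leg12 R) = 0 in
  let C2 := commutator (leg23 chi)
              ((leg23 R)^-1 * leg13 chi * leg23 R) = 0 in
  let C3 := commutator (leg12 chi) (leg23 chi) = 0 in
  (C1 <-> C2) /\ (C2 <-> C3) /\
  (C1 \/ C2 \/ C3 ->
   fps_quasitriangular Delta
     (fpsC R * fps_exp (fpsX (H ⊗ H)%type * fpsC chi))).
Proof.
move: Hpc => [_ [UR Rop Rid RDid] chiD chi_id chi_Did] C1 C2 C3.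
have U12 : leg12 R \is a GRing.unit by apply: rmorph_unit.
have U13 : leg13 R \is a GRing.unit by apply: rmorph_unit.
have U23 : leg23 R \is a GRing.unit by apply: rmorph_unit.
have C31 : C3 <-> C1.
  rewrite /C3 /C1 !commutator_eq0.
  rewrite (comm_conj_transfer (y := leg13 chi) U23 U13).
  - split=> /(rmorph_comm_conj (@swap23 k H)).
      by rewrite /= !swap23_leg13 swap23_leg12; apply.
    by rewrite /= !swap23_leg12 swap23_leg13; apply.
  - by rewrite -chi_Did; apply: leg12_comm_Delta_id.
  - by rewrite -RDid; apply: leg12_comm_Delta_id.
have C32 : C3 <-> C2.
  rewrite /C3 /C2 !commutator_eq0.
  transitivity (GRing.comm (leg23 chi) (leg12 chi)).
    by split; apply: commr_sym.
  rewrite (comm_conj_transfer (y := leg13 chi) U12 U13).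
  - split=> /(rmorph_comm_conj (@swap12 k H)).
      by rewrite /= !swap12_leg13 swap12_leg23; apply.
    by rewrite /= !swap12_leg23 swap12_leg13; apply.
  - by rewrite -chi_id; apply: leg23_comm_id_Delta.
  - by rewrite -Rid; apply: leg23_comm_id_Delta.
split; first by rewrite -C31.
split; first by rewrite C32.
move=> C123.
have {C123} c3 : C3 by case: C123 => [/C31|[/C32|]].
have /commutator_eq0 c1 := C31.1 c3.
have /commutator_eq0 c2 := C32.1 c3.
rewrite -/(exph chi); split.
- by rewrite unitrMl ?fpsC_unit // exph_unit.
- move=> x; rewrite invrM ?fpsC_unit ?exph_unit // fpsCV //.
  have Dx : GRing.comm (exph chi) (fps_map Delta x).
    by apply: exph_comm_coef => n; apply: chiD.
  rewrite !mulrA -(mulrA (fpsC R)) Dx !mulrA mulrK ?exph_unit //.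
  by apply/fpsP => n; rewrite fpsMC_coef fpsCM_coef; apply: Rop.
- by rewrite !fps_mapM !fps_mapC !fps_map_exph /= Rid chi_id exp_hexagon.
- by rewrite !fps_mapM !fps_mapC !fps_map_exph /= RDid chi_Did exp_hexagon.
Qed.
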